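(* Let $r\ge2$ be an integer and let $R>0$ be fixed. Let $d$ be the homogeneous quasi-distance on the stratified free-nilpotent group $\mathbb F_{r2}$ of step $2$ and rank $r$ whose unit ball centered at the origin is $$B_d(0,1)=\{p\in\mathbb F_{r2}:\ \|p\|^2\le R^2\},$$ where $\|\cdot\|$ is the Euclidean norm in exponential coordinates of the first kind associated to the basis $(X_1,\dots,X_r,(X_{ij})_{1\le i<j\le r})$. Then the Besicovitch Covering Property (BCP) holds on $(\mathbb F_{r2},d)$.
   Context: $\mathbb F_{r2}$ is the connected, simply connected Lie group whose Lie algebra $\mathfrak f_{r2}=V\oplus W$ is the free-nilpotent Lie algebra of step 2 and rank $r$, with stratification $[V,V]=W$, $\dim V=r$, $\dim W=r(r-1)/2$. Fix a basis $(X_1,\dots,X_r)$ of $V$ and set $X_{ij}:=[X_i,X_j]$, so $(X_{ij})_{1\le i<j\le r}$ is a basis of $W$. A point $p=\exp(\sum_i p_iX_i+\sum_{i<j}p_{ij}X_{ij})$ is identified with $(v_p,w_p)$, $v_p=(p_1,\dots,p_r)$, $w_p=(p_{ij})_{i<j}$. The group law is $v_{p\cdot q}=v_p+v_q$ and $(p\cdot q)_{ij}=p_{ij}+q_{ij}+\frac12(p_iq_j-q_ip_j)$ for $1\le i<j\le r$; the identity is the origin $0$. Dilations are $\delta_\lambda(p)=(\lambda v_p,\lambda^2w_p)$, $\lambda>0$. The Euclidean norm is $\|p\|^2=\sum_i p_i^2+\sum_{i<j}p_{ij}^2$. A quasi-distance on a nonempty set $X$ is a symmetric map $d:X\times X\to[0,+\infty)$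 with $d(p,q)=0$ iff $p=q$ and, for some $C\ge1$, $d(p,q)\le C(d(p,p')+d(p',q))$ for all $p,p',q$. Balls are the sets $B_d(p,\rho):=\{q\in X:d(q,p)\le\rho\}$, $\rho>0$. A quasi-distance on $\mathbb F_{r2}$ is homogeneous if it is left-invariant and $d(\delta_\lambda(p),\delta_\lambda(q))=\lambda d(p,q)$ for all $p,q$ and $\lambda>0$. The homogeneous quasi-distance with the stated unit ball is $d(p,q)=\inf\{\lambda>0:\|\delta_{1/\lambda}(p^{-1}\cdot q)\|\le R\}$; it is a well-defined homogeneous quasi-distance. BCP: a quasi-metric space $(X,d)$ satisfies BCP if there is a constant $N\ge1$ such that, for every bounded $A\subset X$ and every family $\mathcal B$ of balls such that each point of $A$ is the center of some ball of $\mathcal B$, there is a finite or countable subfamily $\mathcal F\subset\mathcal B$ whose balls cover $A$ and such that every point of $X$ belongs to at most $N$ balls of $\mathcal F$. *)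

(* Defs.v *)
From HB Require Import structures.
From mathcomp Require Import all_boot all_order all_algebra.
From mathcomp Require Import ring lra.
From mathcomp Require Import all_classical all_reals.

Set Implicit Arguments.
Unset Strict Implicit.
Unset Printing Implicit Defensive.

Import Order.TTheory GRing.Theory Num.Theory.

Local Open Scope classical_set_scope.
Local Open Scope ring_scope.

Section QuasiMetric.
Variables (R : realType) (T : Type).
Implicit Types (d : T -> T -> R) (A B : set T).

Definition quasi_distance d : Prop :=
  [/\ forall p q, 0 <= d p q,
      forall p q, d p q = d q p,
      forall p q, d p q = 0 <-> p = q
    & exists2 C : R, 1 <= C &
        forall p p' q, d p q <= C * (d p p' + d p' q)].

Definition qball d (p : T) (rho : R) : set T := [set q | d q p <= rho].

Definition qbounded d A : Prop :=
  exists M : R, forall p q, A p -> A q -> d p q <= M.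

(* Balls are treated as sets: a family of balls is a set of subsets of T, each
   equal to qball d p rho for some p and some rho > 0. *)
Definition BCP d : Prop :=
  exists2 N : nat, (1 <= N)%N &
    forall (A : set T) (Bs : set (set T)),
      qbounded d A ->
      (forall B, Bs B -> exists p, exists2 rho, 0 < rho & B = qball d p rho) ->
      (forall a, A a -> exists2 rho, 0 < rho & Bs (qball d a rho)) ->
      exists Fs : set (set T),
        [/\ Fs `<=` Bs, countable Fs, A `<=` \bigcup_(B in Fs) B
          & forall x, ([set B | Fs B /\ B x] #<= `I_N)%card].

End QuasiMetric.

(* The pairs i < j indexing the basis X_ij = [X_i, X_j] of the second layer. *)
Definition upair (r : nat) := {ij : 'I_r * 'I_r | (ij.1 < ij.2)%N}.

(* F_{r2} in exponential coordinates of the first kind: p = (v_p, w_p). *)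
Definition fr2 (R : realType) (r : nat) : Type :=
  ('rV[R]_r * {ffun upair r -> R})%type.
HB.instance Definition _ R r := Choice.on (fr2 R r).

Section FreeStep2.
Variables (R : realType) (r : nat).
Implicit Types (p q : fr2 R r) (ij : upair r).

Definition fr2_one : fr2 R r := (0, [ffun => 0]).

Definition fr2_inv p : fr2 R r := (- p.1, [ffun ij => - p.2 ij]).

Definition fr2_mul p q : fr2 R r :=
  (p.1 + q.1,
   [ffun ij : upair r => let: (i, j) := val ij in
     p.2 ij + q.2 ij + 2^-1 * (p.1 0 i * q.1 0 j - q.1 0 i * p.1 0 j)]).

Lemma fr2P p q : p.1 = q.1 -> (forall ij, p.2 ij = q.2 ij) -> p = q.
Proof. by case: p q => [v w] [v' w'] /= -> /ffunP ->. Qed.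

Lemma fr2_mulA : associative fr2_mul.
Proof.
move=> x y z; apply: fr2P => [|[[i j] ltij]]; first exact: addrA.
by rewrite !ffunE /= ?ffunE /= !mxE; ring.
Qed.

Lemma fr2_mul1 : left_id fr2_one fr2_mul.
Proof.
move=> x; apply: fr2P => [|[[i j] ltij]]; first exact: add0r.
by rewrite /= !ffunE /= !mxE; ring.
Qed.

Lemma fr2_mulr1 : right_id fr2_one fr2_mul.
Proof.
move=> x; apply: fr2P => [|[[i j] ltij]]; first exact: addr0.
by rewrite /= !ffunE /= !mxE; ring.
Qed.

Lemma fr2_mulV : left_inverse fr2_one fr2_inv fr2_mul.
Proof.
move=> x; apply: fr2P => [|[[i j] ltij]]; first exact: addNr.
by rewrite /= !ffunE /= !mxE; ring.
Qed.

Lemma fr2_mulrV : right_inverse fr2_one fr2_inv fr2_mul.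
Proof.
move=> x; apply: fr2P => [|[[i j] ltij]]; first exact: addrN.
by rewrite /= !ffunE /= !mxE; ring.
Qed.

HB.instance Definition _ := isGroup.Build (fr2 R r)
  fr2_mulA fr2_mul1 fr2_mulr1 fr2_mulV fr2_mulrV.

Definition dil (l : R) p : fr2 R r :=
  (l *: p.1, [ffun ij => l ^+ 2 * p.2 ij]).

Definition enorm p : R :=
  Num.sqrt (\sum_i p.1 0 i ^+ 2 + \sum_ij p.2 ij ^+ 2).

Definition homogeneous_quasi_distance (d : fr2 R r -> fr2 R r -> R) : Prop :=
  [/\ quasi_distance d,
      forall g p q, d (g * p)%g (g * q)%g = d p q
    & forall l p q, 0 < l -> d (dil l p) (dil l q) = l * d p q].

End FreeStep2.

(* The hypotheses of homogeneity and of having the Euclidean ball of radius rho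
   as unit ball determine a distance: it exists, is unique and equals hdist. *)
Section UnitBall.
Variables (R : realType) (r : nat) (rho : R).
Hypothesis rho_gt0 : 0 < rho.
Implicit Types (p q : fr2 R r) (ij : upair r) (l : R).

Definition hdist p q : R :=
  inf [set l | 0 < l /\ enorm (dil l^-1 (p^-1 * q)%g) <= rho].

Let nv p : R := \sum_i p.1 0 i ^+ 2.
Let nw p : R := \sum_ij p.2 ij ^+ 2.
Let gauge p : R :=
  Num.sqrt ((nv p + Num.sqrt (nv p ^+ 2 + 4 * rho ^+ 2 * nw p))
            / (2 * rho ^+ 2)).

Let nv_ge0 p : 0 <= nv p.
Proof. by apply: sumr_ge0 => i _; exact: sqr_ge0. Qed.

Let nw_ge0 p : 0 <= nw p.
Proof. by apply: sumr_ge0 => i _; exact: sqr_ge0. Qed.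

#[local] Hint Resolve nv_ge0 nw_ge0 : core.

Let nv_dil l p : nv (dil l p) = l ^+ 2 * nv p.
Proof. by rewrite mulr_sumr; apply: eq_bigr => i _; rewrite !mxE exprMn. Qed.

Let nw_dil l p : nw (dil l p) = l ^+ 4 * nw p.
Proof.
by rewrite mulr_sumr; apply: eq_bigr => i _; rewrite !ffunE exprMn -exprM.
Qed.

Let enorm_le p : (enorm p <= rho) = (nv p + nw p <= rho ^+ 2).
Proof.
rewrite -(@ler_sqr _ (enorm p)) ?nnegrE ?sqrtr_ge0 ?(ltW rho_gt0)//.
by rewrite sqr_sqrtr//; exact: addr_ge0 (nv_ge0 p) (nw_ge0 p).
Qed.

Let enorm_dilP l p : 0 < l ->
  (enorm (dil l^-1 p) <= rho) =
  (nv p * l ^+ 2 + nw p <= rho ^+ 2 * (l ^+ 2) ^+ 2).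
Proof.
move=> l0; rewrite enorm_le nv_dil nw_dil.
have l4 : 0 < (l ^+ 2) ^+ 2 by rewrite !exprn_gt0.
rewrite -(ler_pM2r l4); congr (_ <= _).
by have ? := lt0r_neq0 l0; field.
Qed.

Let quad_le (a b c t : R) : 0 <= a -> 0 <= b -> 0 < c -> 0 < t ->
  (a * t + b <= c * t ^+ 2) =
  ((a + Num.sqrt (a ^+ 2 + 4 * c * b)) / (2 * c) <= t).
Proof.
move=> a0 b0 c0 tp.
have D0 : 0 <= a ^+ 2 + 4 * c * b by rewrite addr_ge0 ?sqr_ge0// !mulr_ge0// ltW.
rewrite ler_pdivrMr ?mulr_gt0//.
set s := Num.sqrt _.
have s0 : 0 <= s by exact: sqrtr_ge0.
have sE : s ^+ 2 = a ^+ 2 + 4 * c * b by rewrite sqr_sqrtr.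
have as_ : a <= s by rewrite -ler_sqr ?nnegrE// sE lerDl !mulr_ge0// ltW.
apply/idP/idP => h.
- rewrite leNgt; apply/negP => h'.
  have [h1|h1] := leP 0 (t * (2 * c) - a).
    have : (t * (2 * c) - a) ^+ 2 < s ^+ 2.
      by rewrite ltr_sqr ?nnegrE//; lra.
    rewrite sE => h2; suff: 4 * c * (c * t ^+ 2) < 4 * c * (a * t + b).
      by rewrite ltr_pM2l ?mulr_gt0//; lra.
    by nra.
  suff: c * t ^+ 2 < a * t + b by lra.
  have : 0 < t * (a - c * t) by rewrite mulr_gt0//; have := mulr_gt0 tp c0; lra.
  by lra.
- have : s ^+ 2 <= (t * (2 * c) - a) ^+ 2.
    by rewrite ler_sqr ?nnegrE//; lra.
  rewrite sE => h2; rewrite -(@ler_pM2l _ (4 * c)) ?mulr_gt0//.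
  by lra.
Qed.

Let gauge_ge0 p : 0 <= gauge p.
Proof. exact: sqrtr_ge0. Qed.

Let gaugeP l p : 0 < l -> (enorm (dil l^-1 p) <= rho) = (gauge p <= l).
Proof.
move=> l0; have l2 : 0 < l ^+ 2 by exact: exprn_gt0.
rewrite enorm_dilP// quad_le ?exprn_gt0//.
rewrite -[in RHS]ler_sqr ?nnegrE ?(ltW l0)// sqr_sqrtr// divr_ge0 ?addr_ge0//.
  exact: sqrtr_ge0.
by rewrite mulr_ge0// sqr_ge0.
Qed.

Let gauge_eq (x y : R) : 0 <= x -> 0 <= y ->
  (forall l, 0 < l -> (x <= l) = (y <= l)) -> x = y.
Proof.
move=> x0 y0 h; apply/eqP; rewrite eq_le; apply/andP.
by split; apply/ler_addgt0Pr => e e0; [rewrite h|rewrite -h]; lra.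
Qed.

Let hdistE p q : hdist p q = gauge (p^-1 * q)%g.
Proof.
rewrite /hdist; set x := (_ * _)%g; set S := [set _ | _].
have SE l : S l <-> 0 < l /\ gauge x <= l.
  by split=> -[l0 h]; split=> //; rewrite gaugeP in h *.
have S1 : S (gauge x + 1) by apply/SE; split; have := gauge_ge0 x; lra.
have lbS : lbound S (gauge x) by move=> l /SE[].
apply/eqP; rewrite eq_le; apply/andP; split; last first.
  by apply: lb_le_inf => //; exists (gauge x + 1).
apply/ler_addgt0Pr => e e0; apply: ge_inf; first by exists (gauge x).
by apply/SE; have := gauge_ge0 x; split; lra.
Qed.

Let gaugeP' l p : 0 < l ->
  (gauge p <= l) = (nv p * l ^+ 2 + nw p <= rho ^+ 2 * (l ^+ 2) ^+ 2).
Proof. by move=> l0; rewrite -gaugeP// enorm_dilP. Qed.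

Let nvw_eq0 p : nv p = 0 -> nw p = 0 -> p = 1%g.
Proof.
move=> /eqP v0 /eqP w0; apply: fr2P => [|ij].
  apply/rowP => i; rewrite mxE; apply/eqP; rewrite -sqrf_eq0; apply/eqP.
  by move: v0; rewrite psumr_eq0 => [/allP/(_ i)|? _];
    [rewrite mem_index_enum => /(_ isT)/eqP|exact: sqr_ge0].
rewrite ffunE; apply/eqP; rewrite -sqrf_eq0; apply/eqP.
by move: w0; rewrite psumr_eq0 => [/allP/(_ ij)|? _];
  [rewrite mem_index_enum => /(_ isT)/eqP|exact: sqr_ge0].
Qed.

Let nv1 : nv 1%g = 0.
Proof. by apply: big1 => i _; rewrite mxE expr0n. Qed.

Let nw1 : nw 1%g = 0.
Proof. by apply: big1 => i _; rewrite ffunE expr0n. Qed.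

Let gauge_eq0 p : gauge p = 0 <-> p = 1%g.
Proof.
split=> [/eqP|->]; last first.
  by rewrite /gauge nv1 nw1 expr0n /= mulr0 !addr0 sqrtr0 addr0 mul0r sqrtr0.
have c0 : 0 < rho ^+ 2 by exact: exprn_gt0.
have := nv_ge0 p; have := nw_ge0 p; rewrite /gauge => w0 v0.
rewrite sqrtr_eq0 pmulr_lle0 ?invr_gt0 ?mulr_gt0// => h.
have s0 := sqrtr_ge0 (nv p ^+ 2 + 4 * rho ^+ 2 * nw p).
have vE : nv p = 0 by lra.
have : Num.sqrt (nv p ^+ 2 + 4 * rho ^+ 2 * nw p) = 0 by lra.
move=> /eqP; rewrite sqrtr_eq0 vE expr0n /= add0r pmulr_rle0 ?mulr_gt0// => h'.
by apply: nvw_eq0 => //; lra.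
Qed.

Let nvV p : nv p^-1%g = nv p.
Proof. by apply: eq_bigr => i _; rewrite mxE sqrrN. Qed.

Let nwV p : nw p^-1%g = nw p.
Proof. by apply: eq_bigr => i _; rewrite ffunE sqrrN. Qed.

Let gaugeV p : gauge p^-1%g = gauge p.
Proof. by rewrite /gauge nvV nwV. Qed.

Let dilM l p q : dil l (p * q)%g = (dil l p * dil l q)%g.
Proof.
apply: fr2P => [|[[i j] ltij]]; first exact: scalerDr.
by rewrite !ffunE /= ?ffunE /= !mxE; ring.
Qed.

Let dilV l p : dil l p^-1%g = (dil l p)^-1%g.
Proof.
apply: fr2P => [|[[i j] ltij]]; first exact: scalerN.
by rewrite !ffunE mulrN.
Qed.

Let dil_comp l m p : dil l (dil m p) = dil (l * m) p.
Proof.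
apply: fr2P => [|ij]; first exact: scalerA.
by rewrite !ffunE; ring.
Qed.

Let gauge_dil l p : 0 < l -> gauge (dil l p) = l * gauge p.
Proof.
move=> l0; apply: gauge_eq => [||m m0]; rewrite ?mulr_ge0 ?(ltW l0)//.
rewrite -gaugeP// dil_comp -[in RHS]ler_pdivlMl// -gaugeP ?mulr_gt0 ?invr_gt0//.
by rewrite invfM invrK mulrC.
Qed.

Let nv_mul p q : nv (p * q)%g <= 2 * nv p + 2 * nv q.
Proof.
rewrite !mulr_sumr -big_split; apply: ler_sum => i _ /=; rewrite !mxE.
by have := sqr_ge0 (p.1 0 i - q.1 0 i); lra.
Qed.

Let nw_mul p q : nw (p * q)%g <= 3 * nw p + 3 * nw q + 3 * (nv p * nv q).
Proof.
pose c (u : 'I_r * 'I_r) := p.1 0 u.1 ^+ 2 * q.1 0 u.2 ^+ 2.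
have c0 (u : 'I_r * 'I_r) : 0 <= c u by rewrite mulr_ge0 ?sqr_ge0.
have cS : \sum_(u : 'I_r * 'I_r) c u = nv p * nv q.
  by rewrite mulr_suml; under [RHS]eq_bigr do rewrite mulr_sumr; rewrite pair_big.
have cS' : \sum_(u : 'I_r * 'I_r) c (u.2, u.1) = nv p * nv q.
  rewrite -cS (reindex_inj (h := fun u : 'I_r * 'I_r => (u.2, u.1)))/=.
    by apply: eq_bigr => -[].
  by move=> [? ?] [? ?] [-> ->].
have sub (F : 'I_r * 'I_r -> R) : (forall u : 'I_r * 'I_r, 0 <= F u) ->
    \sum_(u : upair r) F (val u) <= \sum_(u : 'I_r * 'I_r) F u.
  move=> F0; rewrite -(big_sub [pred u : 'I_r * 'I_r | (u.1 < u.2)%N]).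
  rewrite [leRHS](bigID [pred u : 'I_r * 'I_r | (u.1 < u.2)%N]) lerDl /=.
  exact: sumr_ge0.
have h1 := sub c c0; rewrite cS in h1.
have h2 := sub (fun u : 'I_r * 'I_r => c (u.2, u.1)) (fun=> c0 _); rewrite cS' in h2.
suff: nw (p * q)%g <= 3 * nw p + 3 * nw q +
    (3 / 2 * (\sum_(u : upair r) c (val u)) +
     3 / 2 * (\sum_(u : upair r) c ((val u).2, (val u).1))) by lra.
rewrite !mulr_sumr -!big_split; apply: ler_sum => -[[i j] ltij] _ /=.
rewrite !ffunE /c /=.
move: (p.2 _) (q.2 _) (p.1 0 i) (p.1 0 j) (q.1 0 i) (q.1 0 j) => a b x y x' y'.
rewrite -subr_ge0.
have -> : 3 * a ^+ 2 + 3 * b ^+ 2 + (3 / 2 * (x ^+ 2 * y' ^+ 2) +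
    3 / 2 * (y ^+ 2 * x' ^+ 2)) - (a + b + 2^-1 * (x * y' - x' * y)) ^+ 2 =
  (a - b) ^+ 2 + (a - 2^-1 * (x * y' - x' * y)) ^+ 2 +
  (b - 2^-1 * (x * y' - x' * y)) ^+ 2 + 3 / 4 * (x * y' + x' * y) ^+ 2.
  by field.
by rewrite !addr_ge0 ?sqr_ge0// mulr_ge0 ?sqr_ge0 ?divr_ge0.
Qed.

Let gauge_mul : exists2 C, 1 <= C &
  forall p q, gauge (p * q)%g <= C * (gauge p + gauge q).
Proof.
pose C := 10 + 3 * rho ^+ 2.
have c0 : 0 < rho ^+ 2 by exact: exprn_gt0.
exists C; first by rewrite /C; lra.
move=> p q; set s := gauge p + gauge q.
have [gp gq] := (gauge_ge0 p, gauge_ge0 q).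
have [s0|s0] := eqVneq s 0.
  have /gauge_eq0 -> : gauge p = 0 by move: s0; rewrite /s; lra.
  have /gauge_eq0 -> : gauge q = 0 by move: s0; rewrite /s; lra.
  rewrite mulg1 (gauge_eq0 1%g).2// s0; lra.
have sp : 0 < s by rewrite lt_neqAle eq_sym s0 addr_ge0.
have hp : gauge p <= s by rewrite /s; lra.
have hq : gauge q <= s by rewrite /s; lra.
move: hp hq; rewrite !gaugeP' ?mulr_gt0//; try by rewrite /C; lra.
have s2 : 0 < s ^+ 2 by exact: exprn_gt0.
rewrite (exprMn _ C); set t := s ^+ 2 in s2 *.
have := nv_mul p q; have := nw_mul p q.
have := nv_ge0 p; have := nw_ge0 p; have := nv_ge0 q; have := nw_ge0 q.
move: (nv p) (nv q) (nw p) (nw q) (nv (p * q)%g) (nw (p * q)%g).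
set k := rho ^+ 2 in c0 *.
move=> a a' b b' A B b'0 a'0 b0 a0 hB hA h h'.
have at0 : a <= k * t by rewrite -(ler_pM2r s2); lra.
have at0' : a' <= k * t by rewrite -(ler_pM2r s2); lra.
have kt : 0 < k * t ^+ 2 by rewrite mulr_gt0 ?exprn_gt0.
have bt : b <= k * t ^+ 2 by have := mulr_ge0 a0 (ltW s2); lra.
have bt' : b' <= k * t ^+ 2 by have := mulr_ge0 a'0 (ltW s2); lra.
have aa : a * a' <= (k * t) * (k * t) by exact: ler_pM.
have CE : C = 10 + 3 * k by [].
have C2 : 100 <= C ^+ 2 by rewrite CE; nra.
have C2' : C <= C ^+ 2 by rewrite CE; nra.
have C4 : 4 * C ^+ 2 + 6 + 3 * k <= (C ^+ 2) ^+ 2.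
  by have := ler_wpM2l (sqr_ge0 C) C2; lra.
have hA' : A * (C ^+ 2 * t) <= (4 * k * t) * (C ^+ 2 * t).
  by apply: ler_wpM2r; [rewrite mulr_ge0 ?sqr_ge0 ?ltW|lra].
have := ler_wpM2r (ltW kt) C4.
by lra.
Qed.

Lemma hdist_homogeneous : homogeneous_quasi_distance hdist.
Proof.
split.
- split=> [p q|p q|p q|].
  + by rewrite hdistE.
  + by rewrite !hdistE -gaugeV invgM invgK.
  + rewrite hdistE; apply: (iff_trans (gauge_eq0 _)); split=> [h|->].
      by rewrite -[RHS](mulVKg p) h mulg1.
    by rewrite mulVg.
  + have [C C1 h] := gauge_mul; exists C => // p p' q; rewrite !hdistE.
    by apply: le_trans (h _ _); rewrite mulgA mulgK.
- by move=> g p q; rewrite !hdistE invgM -mulgA mulKg.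
- by move=> l p q l0; rewrite !hdistE -gauge_dil// dilM dilV.
Qed.

Let enorm_sqr_le p : (enorm p ^+ 2 <= rho ^+ 2) = (gauge p <= 1).
Proof.
rewrite -gaugeP// invr1; have -> : dil 1 p = p.
  by apply: fr2P => [|ij]; rewrite ?ffunE /= ?scale1r ?expr1n ?mul1r.
by rewrite -[RHS]ler_sqr ?nnegrE ?sqrtr_ge0 ?(ltW rho_gt0).
Qed.

Lemma hdist_ball : qball hdist 1%g 1 = [set p | enorm p ^+ 2 <= rho ^+ 2].
Proof.
by apply/seteqP; split=> p; rewrite /qball /= enorm_sqr_le hdistE mulg1 gaugeV.
Qed.

Lemma homogeneous_ball_uniq d : homogeneous_quasi_distance d ->
  qball d 1%g 1 = [set p | enorm p ^+ 2 <= rho ^+ 2] -> d = hdist.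
Proof.
move=> [[d0 dC dE _] dM dZ] dB; apply/funext => p; apply/funext => q.
rewrite hdistE -(dM p^-1%g) mulVg; set x := (_ * _)%g.
apply: gauge_eq => // l l0.
have dil1 : dil l^-1 (1%g : fr2 R r) = 1%g.
  apply: fr2P => [|ij]; first exact: scaler0.
  by rewrite !ffunE mulr0.
have l'0 : 0 < l^-1 by rewrite invr_gt0.
rewrite -[l in RHS]mulr1 -ler_pdivrMl// -gauge_dil// -enorm_sqr_le.
rewrite -[l in LHS]mulr1 -ler_pdivrMl// -dZ// dil1 dC.
by apply/idP/idP; move: dB => /seteqP[h1 h2]; [move/h1|move/h2].
Qed.

End UnitBall.

(* Main.v *)
Require Import Defs.
From mathcomp Require Import all_boot all_order all_algebra.
From mathcomp Require Import ring lra.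
From mathcomp Require Import all_classical all_reals.

(** Why BCP holds.

    The geometric heart is a local statement on the unit sphere.  Write
    points as (v, w) and let p = (v, w), q = (v', w') be at distance 1 from the
    origin, with nearby coordinates and, moreover, with nearby directions v/|v|
    and v'/|v'|.  Then d(p, delta_l q) <= 1 for every l in ]0, 1]
    ([sqn_scaled_diff], [exists_besicovitch_radius]).  Indeed
    (delta_l q)^-1 p has components v - l v' and w - l^2 w' + (l/2) [v, v'];
    when its square norm is expanded, the first-order gain 2 l <v, v'> has to
    beat the bracket terms, of size l |[v, v']|.  Near the vertical axis v = 0
    both quantities are small, and it is the closeness of the directions that
    makes |[v, v']| a small multiple of <v, v'> ([dir_close]).  Once the bracket
    is absorbed, the square norm has dropped below that of p by at least
    l^2 (|p|^2 - |p - q|^2 - small), which is nonnegative for every l.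

    Finitely many cells of a grid cover all the possible values of v, w and
    v/|v|.  Hence around each point x the space can be coloured with finitely
    many colours so that two points p, q of the same colour satisfy
    d(p, q) <= max(d(x, p), d(x, q)) ([besicovitch_coloring]).  In other words,
    balls with a common point x, none of which contains the centre of another,
    are boundedly many.  A grid also shows that balls are totally bounded,
    uniformly in centre and radius ([ball_coloring]).

    These two colourings imply BCP by the classical greedy selection
    ([BCP_of_colorings]).  Balls are treated by dyadic layers of decreasing
    radius; in each layer, among the centres not covered so far, one keeps a
    maximal separated set.  Two selected balls through x whose
    centres have the same Besicovitch colour must lie in the same layer, since
    otherwise the smaller one would be centred outside the larger one but at a
    distance at most the larger radius; inside a layer, separation and
    total boundedness leave one centre per cell.  The overlap is thus at most
    the product of the two numbers of colours. *)

Import Order.TTheory GRing.Theory Num.Theory.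

Local Open Scope classical_set_scope.
Local Open Scope ring_scope.

(** * Finite colourings *)

(** Boundedness and covering statements are all phrased as the existence of a
    finite colouring whose monochromatic pairs satisfy [P]; this makes
    cardinality bounds a matter of injectivity of the colouring. *)
Definition colorable (K : finType) {T : Type} (P : T -> T -> Prop) : Prop :=
  exists c : T -> K, forall p q, c p = c q -> P p q.

Lemma inj_card_le_finType (T : Type) (K : finType) (X : set T) (c : T -> K) :
  (forall p q, X p -> X q -> c p = c q -> p = q) -> (X #<= `I_#|K|)%card.
Proof.
move=> c_inj; have c_inj' : {in X &, injective (fun p => nat_of_ord (enum_rank (c p)))}.
  move=> p q /set_mem Xp /set_mem Xq cE; apply: c_inj => //.
  by apply: enum_rank_inj; apply: val_inj.
rewrite -(card_le_eql (inj_card_eq c_inj')).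
by apply: subset_card_le => _ [p _ <-] /=; exact: ltn_ord.
Qed.

(** The colour of [x] is the cell of side [e] of the cube of half-side [B] that
    contains it.  Outside the cube the colour carries no information. *)
Lemma grid_coloring (R : realType) (I : finType) (B e : R) : 0 < e ->
  exists K, colorable K (fun x y : I -> R =>
    (forall i, `|x i| <= B) -> (forall i, `|y i| <= B) ->
    forall i, `|x i - y i| <= e).
Proof.
move=> e0; pose n := Num.truncn (2 * B / e).
pose cell (t : R) : 'I_n.+1 := inord (Num.truncn ((t + B) / e)).
exists {ffun I -> 'I_n.+1}, (fun x => [ffun i => cell (x i)]).
move=> x y /ffunP cxy xB yB i; move: (cxy i) (xB i) (yB i); rewrite !ffunE.
move: (x i) (y i) => {xB yB cxy} s t cE /ler_normlP[sB1 sB2] /ler_normlP[tB1 tB2].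
have cellE u : - u <= B -> u <= B ->
    (cell u : nat)%:R * e <= u + B < (cell u)%:R * e + e.
  move=> u1 u2.
  have -> : (cell u : nat)%:R * e + e = (cell u).+1%:R * e.
    by rewrite -natr1 mulrDl mul1r.
  rewrite -ler_pdivlMr// -ltr_pdivrMr//.
  have u0 : 0 <= (u + B) / e by rewrite divr_ge0 ?(ltW e0)//; lra.
  rewrite inordK ?truncn_itv// ltnS /n; apply: le_truncn.
  by rewrite ler_pM2r ?invr_gt0//; lra.
have := cellE s sB1 sB2; have := cellE t tB1 tB2; rewrite cE.
move=> /andP[? ?] /andP[? ?].
by apply/ler_normlP; split; lra.
Qed.

(** * From colourings to the covering property *)

Section Covering.
Variables (R : realType) (T : Type) (d : T -> T -> R).

Definition separated (e : R) (S : set T) : Prop :=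
  forall a b, S a -> S b -> a <> b -> e < d a b.

(** A maximal [e]-separated subset is an [e]-net: a point at distance more than
    [e] from all of it could be added. *)
Lemma exists_net (e : R) (U : set T) :
  (forall p q, d p q = d q p) -> (forall p, d p p <= e) ->
  exists S, [/\ S `<=` U, separated e S
    & forall c, U c -> exists2 a, S a & d c a <= e].
Proof.
move=> dC de.
have [F F_total_sub|S [[SU Ssep] Smax]] :=
    @Zorn_bigcup T [set S | S `<=` U /\ separated e S].
  move=> Ftot; split=> [p [S FS Sp]|a b [S FS Sa] [S' FS' Sb]].
    by have [SU _] := F_total_sub _ FS; exact: SU.
  have [SS'|S'S] := Ftot _ _ FS FS'.
    by have [_] := F_total_sub _ FS'; apply => //; exact: SS'.
  by have [_] := F_total_sub _ FS; apply => //; exact: S'S.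
exists S; split=> // c Uc; apply: contrapT => ncov.
have far a : S a -> e < d c a.
  by move=> Sa; rewrite ltNge; apply/negP => le; apply: ncov; exists a.
apply: (Smax (S `|` [set c])); first split.
- by move=> p; left.
- move=> ScS; have Sc : S c by apply: ScS; right.
  by apply: ncov; exists c.
- split=> [p [/SU//|->//]|a b [Sa|->] [Sb|->]] //; first exact: Ssep.
    by rewrite dC => _; exact: far.
  by move=> _; exact: far.
Qed.

Lemma dyadic_layer (M r : R) : 0 < r -> r <= M ->
  exists k, M / 2 ^+ k.+1 < r <= M / 2 ^+ k.
Proof.
move=> r0 rM.
have p2 n : (0 : R) < 2 ^+ n by exact: exprn_gt0.
have ex : exists n, M / 2 ^+ n < r.
  exists (Num.truncn (M / r)); rewrite ltr_pdivrMr// mulrC -ltr_pdivrMr//.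
  apply: lt_le_trans (truncnS_gt _) _.
  by rewrite -natrX ler_nat ltn_expl.
case: (ex_minnP ex) => -[|k] ltk mink.
  by move: ltk; rewrite expr0 divr1 ltNge rM.
exists k; rewrite ltk leNgt; apply/negP => /mink.
by rewrite ltnn.
Qed.

(** The first colouring bounds the number of layers that meet at a point, the
    second one the number of selected centres within a layer. Total boundedness
    at every scale, and not only at scale 1/2, is what makes each layer of the
    selection finite, hence the whole selection countable. *)
Lemma BCP_of_colorings :
  quasi_distance d ->
  (exists K, forall x, colorable K
     (fun p q => d p q <= Num.max (d x p) (d x q))) ->
  (forall e, 0 < e -> exists K, forall x s, 0 < s -> colorable K
     (fun p q => d x p <= s -> d x q <= s -> d p q <= e * s)) ->
  BCP d.
Proof.
move=> [d_ge0 dC d_eq0 _] [K1 col1] col2.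
have dxx x : d x x = 0 by apply/d_eq0.
have half_gt0 : (0 : R) < 2^-1 by rewrite invr_gt0.
have [K2 col2_half] := col2 _ half_gt0.
exists #|{: K1 * K2}|.+1 => // A Bs [M0 M0P] _ ABs.
(* The dyadic scales M / 2^k must be positive, while M0 may be 0. *)
pose M := Num.max M0 1.
have M_gt0 : 0 < M by rewrite lt_max ltr01 orbT.
have MP p q : A p -> A q -> d p q <= M.
  by move=> Ap Aq; rewrite le_max M0P.
have [rad radP] : {rad : T -> R & forall a, A a ->
    0 < rad a /\ Bs (qball d a (rad a))}.
  apply: (@choice _ _ (fun a s => A a -> 0 < s /\ Bs (qball d a s))) => a.
  have [/ABs[s s0 Bss]|nAa] := pselect (A a); first by exists s.
  by exists 0.
have [[a [Aa Ma]]|small] := pselect (exists a, A a /\ M < rad a).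
  (* A ball centred in A of radius more than M already covers A. *)
  exists [set qball d a (rad a)]; split=> [_ ->|||x].
  - by have [] := radP _ Aa.
  - exact: finite_set_countable.
  - move=> b Ab; exists (qball d a (rad a)) => //=.
    by rewrite /qball/=; apply: le_trans (MP _ _ Ab Aa) (ltW Ma).
  - apply: (@card_le_trans _ _ _ [set qball d a (rad a)]).
      by apply: subset_card_le => B [].
    by rewrite (card_le_eql card_set1) card_le_II.
have radM a : A a -> rad a <= M.
  by move=> Aa; rewrite leNgt; apply/negP => lt; apply: small; exists a.
pose s k : R := M / 2 ^+ k.
have s_gt0 k : 0 < s k by rewrite divr_gt0// exprn_gt0.
have sS k : s k.+1 = 2^-1 * s k.
  by rewrite /s exprS invfM; ring.
have s_le j k : (j <= k)%N -> s k <= s j.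
  move=> jk; rewrite /s ler_pM2l// lef_pV2 ?posrE ?exprn_gt0//.
  by rewrite ler_eXn2l// ltr1n.
pose layer k := [set a | A a /\ s k.+1 < rad a <= s k].
have [net netP] : {net : nat * set T -> set T & forall kU,
    [/\ net kU `<=` layer kU.1 `\` kU.2, separated (s kU.1.+1) (net kU)
      & forall c, (layer kU.1 `\` kU.2) c ->
          exists2 a, net kU a & d c a <= s kU.1.+1]}.
  apply: (@choice _ _ (fun kU S => [/\ S `<=` layer kU.1 `\` kU.2,
    separated (s kU.1.+1) S & forall c, (layer kU.1 `\` kU.2) c ->
          exists2 a, S a & d c a <= s kU.1.+1])) => -[k U] /=.
  by apply: exists_net => // p; rewrite dxx ltW.
pose ball a := qball d a (rad a).
(* cov k is the union of the balls selected in the layers before k, and S k the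
   centres selected in layer k. *)
pose cov := fix cov k := if k is j.+1
  then cov j `|` \bigcup_(a in net (j, cov j)) ball a else set0.
pose S k := net (k, cov k).
have SP k a : S k a -> [/\ A a, s k.+1 < rad a <= s k & ~ cov k a].
  by have [/(_ a) sub _ _] := netP (k, cov k) => /sub[[]].
have SA k a : S k a -> A a by move=> /SP[].
have S_sep k : separated (s k.+1) (S k) by have [] := netP (k, cov k).
have cov_mono j k : (j <= k)%N -> cov j `<=` cov k.
  elim: k => [|k IH]; first by rewrite leqn0 => /eqP->.
  by rewrite leq_eqVlt => /orP[/eqP->//|/IH jk] p /jk; left.
have far j k a b : (j < k)%N -> S j a -> S k b -> rad a < d a b.
  move=> jk Sa /SP[_ _ nb]; rewrite ltNge; apply/negP => le.
  apply: nb; apply: (cov_mono _ _ jk); right.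
  by exists a => //; rewrite /ball /qball/= dC.
have layer_cov k : layer k `<=` cov k.+1.
  move=> c lc; have [cc|ncc] := pselect (cov k c); first by left.
  have [_ _ /(_ c)] := netP (k, cov k); case=> // a Sa dca.
  right; exists a => //; rewrite /ball /qball/=.
  by apply: le_trans dca _; have [_ /andP[/ltW]] := SP _ _ Sa.
pose C := \bigcup_k S k.
have cov_sub k : cov k `<=` \bigcup_(a in C) ball a.
  elim: k => [|k IH] p //= [/IH//|[a Sa ba]].
  by exists a => //; exists k.
exists (ball @` C); split.
- by move=> _ [a [k _ Sa] <-]; have [] := radP _ (SA _ _ Sa).
- apply: sub_countable (card_image_le _ _) _.
  apply: bigcup_countable => // k _; apply: finite_set_countable.
  have [[x Ax]|A0] := pselect (exists x, A x); last first.
    suff -> : S k = set0 by exact: finite_set0.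
    by apply/seteqP; split=> // a /SA Aa; apply: A0; exists a.
  (* All of A lies within M of x, and S k is M / 2^(k+1)-separated. *)
  have [|K /(_ x M M_gt0)[c cP]] := col2 (2 ^+ k.+1)^-1.
    by rewrite invr_gt0 exprn_gt0.
  apply: (@card_le_finite _ _ _ `I_#|K|) (finite_II _).
  apply: (@inj_card_le_finType _ _ _ c) => a b Sa Sb /cP le.
  apply: contrapT => ab; have := S_sep k _ _ Sa Sb ab.
  rewrite ltNge /s mulrC => /negP; apply.
  by apply: le; apply: MP => //; [exact: SA Sa|exact: SA Sb].
- move=> a Aa; have [rad0 _] := radP _ Aa.
  have [k lk] := dyadic_layer _ _ rad0 (radM _ Aa).
  have [b Cb bb] := cov_sub _ _ (layer_cov k a (conj Aa lk)).
  by exists (ball b) => //; exists b.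
- move=> x; pose X := [set a | C a /\ ball a x].
  apply: (@card_le_trans _ _ _ (ball @` X)).
    apply: subset_card_le => B [[a Ca <-] Bx].
    by exists a.
  apply: card_le_trans (card_image_le _ _) _.
  apply: (@card_le_trans _ _ _ `I_#|{: K1 * K2}|); last by rewrite card_le_II.
  have [c1 c1P] := col1 x.
  have [c2 c2P] : {c2 : nat -> T -> K2 & forall k p q,
      c2 k p = c2 k q -> d x p <= s k -> d x q <= s k -> d p q <= 2^-1 * s k}.
    apply: (@choice _ _ (fun k (c : T -> K2) => forall p q,
      c p = c q -> d x p <= s k -> d x q <= s k -> d p q <= 2^-1 * s k)) => k.
    by have [c cP] := col2_half x _ (s_gt0 k); exists c.
  (* g a is a layer in which the centre a was selected. *)
  have [g gP] : {g : T -> nat & forall a, C a -> S (g a) a}.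
    apply: (@choice _ _ (fun a k => C a -> S k a)) => a.
    by have [[k _ Sk]|nC] := pselect (C a); [exists k|exists 0%N].
  apply: (@inj_card_le_finType _ _ _ (fun a => (c1 a, c2 (g a) a))).
  move=> a b [/gP Sa xa] [/gP Sb xb] [/c1P c1ab c2ab].
  have notlt u v : S (g u) u -> S (g v) v -> ball u x -> ball v x ->
      d u v <= Num.max (d x u) (d x v) -> (g u < g v)%N -> False.
    move=> Su Sv xu xv le lt.
    have [_ /andP[su _] _] := SP _ _ Su; have [_ /andP[_ sv] _] := SP _ _ Sv.
    have := far _ _ _ _ lt Su Sv; rewrite ltNge => /negP; apply.
    apply: le_trans le _; rewrite ge_max xu/=.
    apply: le_trans xv (le_trans sv (le_trans (s_le _ _ lt) (ltW su))).
  have gab : g a = g b.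
    case: (ltngtP (g a) (g b)) => // lt; exfalso.
      exact: (notlt a b Sa Sb xa xb c1ab).
    by apply: (notlt b a Sb Sa xb xa); rewrite // dC maxC.
  apply: contrapT => ab; rewrite -gab in Sb c2ab.
  have [_ /andP[_ sa] _] := SP _ _ Sa; have [_ /andP[_ sb] _] := SP _ _ Sb.
  have := S_sep _ _ _ Sa Sb ab; rewrite sS ltNge => /negP; apply.
  by apply: c2P => //; [apply: le_trans xa sa|apply: le_trans xb sb].
Qed.

End Covering.

(** * Euclidean geometry of the unit ball *)

Section FreeStep2Geometry.
Context {R : realType} {r : nat}.
Implicit Types (p q z : fr2 R r) (ij : upair r) (l e : R).

Definition sqn p : R := \sum_i p.1 0 i ^+ 2 + \sum_ij p.2 ij ^+ 2.

Definition dot p q : R := \sum_i p.1 0 i * q.1 0 i.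

(** The coordinates of the bracket of the horizontal parts. *)
Definition wedge p q ij : R :=
  p.1 0 (val ij).1 * q.1 0 (val ij).2 - q.1 0 (val ij).1 * p.1 0 (val ij).2.

(** The horizontal direction, with the convention that it vanishes on the
    vertical axis, where [dot p p = 0]. *)
Definition dir p (i : 'I_r) : R := p.1 0 i / Num.sqrt (dot p p).

Lemma dil_mul l p q : dil l (p * q)%g = (dil l p * dil l q)%g.
Proof.
apply: fr2P => [|[[i j] ltij]]; first exact: scalerDr.
by rewrite !ffunE /= ?ffunE /= !mxE; ring.
Qed.

Lemma dil_inv l p : dil l p^-1%g = (dil l p)^-1%g.
Proof.
apply: fr2P => [|[[i j] ltij]]; first exact: scalerN.
by rewrite !ffunE mulrN.
Qed.

Lemma dil_dil l m p : dil l (dil m p) = dil (l * m) p.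
Proof.
apply: fr2P => [|ij]; first exact: scalerA.
by rewrite !ffunE; ring.
Qed.

Lemma dil_1 p : dil 1 p = p.
Proof. by apply: fr2P => [|ij]; rewrite ?ffunE /= ?scale1r ?expr1n ?mul1r. Qed.

Lemma dil_one l : dil l (1%g : fr2 R r) = 1%g.
Proof.
apply: fr2P => [|ij]; first exact: scaler0.
by rewrite !ffunE mulr0.
Qed.

Lemma sqn_dil l p :
  sqn (dil l p) = l ^+ 2 * (\sum_i p.1 0 i ^+ 2) + l ^+ 4 * \sum_ij p.2 ij ^+ 2.
Proof.
rewrite /sqn !mulr_sumr; congr (_ + _); apply: eq_bigr => i _ /=.
  by rewrite !mxE exprMn.
by rewrite ffunE exprMn -exprM.
Qed.

Lemma invM_fst l p q i : ((dil l q)^-1 * p)%g.1 0 i = p.1 0 i - l * q.1 0 i.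
Proof. by rewrite /= !mxE addrC. Qed.

Lemma invM_snd l p q ij :
  ((dil l q)^-1 * p)%g.2 ij = p.2 ij - l ^+ 2 * q.2 ij + l / 2 * wedge p q ij.
Proof.
case: ij => -[i j] ltij; rewrite /wedge /= !ffunE /= !mxE.
by field.
Qed.

Lemma le_sum_sqr (I : finType) (F : I -> R) i : F i ^+ 2 <= \sum_j F j ^+ 2.
Proof.
by rewrite (bigD1 i)//= lerDl sumr_ge0// => j _; exact: sqr_ge0.
Qed.

Lemma sqn_coord (rho : R) p : 0 <= rho -> sqn p <= rho ^+ 2 ->
  (forall i, `|p.1 0 i| <= rho) /\ (forall ij, `|p.2 ij| <= rho).
Proof.
have sum_ge0 (I : finType) (F : I -> R) : 0 <= \sum_i F i ^+ 2.
  by apply: sumr_ge0 => i _; exact: sqr_ge0.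
move=> rho0 le; have abs x : x ^+ 2 <= sqn p -> `|x| <= rho.
  move=> /le_trans/(_ le) le'; rewrite -ler_sqr ?nnegrE//.
  by rewrite real_normK// num_real.
split=> i; apply: abs; rewrite /sqn.
  apply: le_trans (le_sum_sqr _ (fun i => p.1 0 i) i) _.
  by rewrite lerDl.
apply: le_trans (le_sum_sqr _ (fun ij => p.2 ij) i) _.
by rewrite lerDr.
Qed.

(** With t = <v, v'>, the horizontal part of the square norm is exactly
    |v|^2 - l^2 (|v|^2 - |v - v'|^2) - 2 (l - l^2) t, and the vertical part is at
    most |w|^2 - l^2 (|w|^2 - |w - w'|^2) plus bracket terms bounded by l t / 32.
    Adding up leaves a loss of l^2 (|p - q|^2 + t / 32); as t <= rho^2, it is
    paid by l^2 |p|^2 when p is not too close to the origin. *)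
Lemma sqn_scaled_diff (rho l delta : R) p q :
  0 < rho -> 0 < l <= 1 -> 0 <= delta ->
  #|{: upair r}|%:R * (2 * rho * delta + delta ^+ 2 * rho ^+ 2 / 4) <= 32^-1 ->
  sqn p <= rho ^+ 2 -> sqn q <= rho ^+ 2 -> rho ^+ 2 / 16 <= sqn p ->
  \sum_i (p.1 0 i - q.1 0 i) ^+ 2 + \sum_ij (p.2 ij - q.2 ij) ^+ 2
    <= rho ^+ 2 / 32 ->
  0 <= dot p q -> (forall ij, `|wedge p q ij| <= delta * dot p q) ->
  sqn ((dil l q)^-1 * p)%g <= rho ^+ 2.
Proof.
move=> rho0 /andP[l0 l1] delta0 small hp hq hp' near t0 hw.
have [_ p2] := sqn_coord _ _ (ltW rho0) hp.
have [_ q2] := sqn_coord _ _ (ltW rho0) hq.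
set t := dot p q in t0 hw.
have l2 : l ^+ 2 <= l by rewrite expr2 ger_pMr.
have t_le : t <= rho ^+ 2.
  have : 2 * t <= sqn p + sqn q; last lra.
  apply: (@le_trans _ _ (\sum_i p.1 0 i ^+ 2 + \sum_i q.1 0 i ^+ 2)).
    rewrite -big_split mulr_sumr; apply: ler_sum => i _ /=.
    by have := sqr_ge0 (p.1 0 i - q.1 0 i); lra.
  by rewrite /sqn addrACA lerDl addr_ge0// sumr_ge0// => ij _; exact: sqr_ge0.
pose K := 2 * rho * delta + delta ^+ 2 * rho ^+ 2 / 4.
have vE : \sum_i ((dil l q)^-1 * p)%g.1 0 i ^+ 2 =
    \sum_i p.1 0 i ^+ 2 - l ^+ 2 * (\sum_i p.1 0 i ^+ 2
      - \sum_i (p.1 0 i - q.1 0 i) ^+ 2) - 2 * (l - l ^+ 2) * t.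
  rewrite /t /dot -sumrB !mulr_sumr -!sumrB; apply: eq_bigr => i _.
  by rewrite invM_fst; ring.
have wE : \sum_ij ((dil l q)^-1 * p)%g.2 ij ^+ 2 <=
    \sum_ij p.2 ij ^+ 2 - l ^+ 2 * (\sum_ij p.2 ij ^+ 2
      - \sum_ij (p.2 ij - q.2 ij) ^+ 2) + #|{: upair r}|%:R * (l * t * K).
  rewrite -sumrB mulr_sumr -sumrB mulr_natl -sumr_const -big_split.
  apply: ler_sum => ij _; rewrite invM_snd /=.
  move: (p2 ij) (q2 ij) (hw ij); move: (p.2 ij) (q.2 ij) (wedge p q ij).
  move=> a b w ha hb hwt.
  have l4 : (l ^+ 2) ^+ 2 * b ^+ 2 <= l ^+ 2 * b ^+ 2.
    apply: ler_wpM2r; first exact: sqr_ge0.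
    rewrite expr2 ler_piMr ?sqr_ge0//; exact: le_trans l2 l1.
  have cross : (a - l ^+ 2 * b) * w <= 2 * rho * (delta * t).
    apply: le_trans (ler_norm _) _; rewrite normrM; apply: ler_pM => //.
    apply: le_trans (ler_normB _ _) _.
    rewrite normrM ger0_norm ?sqr_ge0//.
    have : l ^+ 2 * `|b| <= 1 * rho.
      by apply: ler_pM => //; [exact: sqr_ge0|exact: le_trans l2 l1].
    by lra.
  have quad : w ^+ 2 <= delta ^+ 2 * rho ^+ 2 * t.
    have : `|w| ^+ 2 <= (delta * t) ^+ 2.
      by rewrite ler_sqr ?nnegrE ?mulr_ge0.
    rewrite real_normK ?num_real// => /le_trans; apply.
    rewrite exprMn -mulrA ler_wpM2l ?sqr_ge0// expr2.
    exact: ler_wpM2r.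
  have := ler_wpM2l (ltW l0) cross.
  have : l ^+ 2 * w ^+ 2 <= l * (delta ^+ 2 * rho ^+ 2 * t).
    by apply: ler_pM => //; exact: sqr_ge0.
  by rewrite /K; lra.
rewrite {1}/sqn vE.
apply: le_trans (lerD (lexx _) wE) _.
have : #|{: upair r}|%:R * (l * t * K) <= 32^-1 * (l * t).
  by rewrite mulrCA mulrC ler_wpM2r// mulr_ge0// ltW.
have : 0 <= l ^+ 2 * (sqn p - \sum_i (p.1 0 i - q.1 0 i) ^+ 2
    - \sum_ij (p.2 ij - q.2 ij) ^+ 2 - t / 32).
  by rewrite mulr_ge0 ?sqr_ge0//; lra.
have : 0 <= (l - l ^+ 2) * t by rewrite mulr_ge0//; lra.
move: hp; rewrite /sqn; lra.
Qed.

Lemma dir_le1 p i : `|dir p i| <= 1.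
Proof.
have le : p.1 0 i ^+ 2 <= dot p p.
  by apply: le_trans (le_sum_sqr _ (fun i => p.1 0 i) i) _.
have dot0 : 0 <= dot p p by apply: le_trans le; exact: sqr_ge0.
rewrite -ler_sqr ?nnegrE// expr1n real_normK ?num_real//.
rewrite /dir expr_div_n sqr_sqrtr//.
have [->|/negPf p0] := eqVneq (dot p p) 0; first by rewrite invr0 mulr0.
by rewrite ler_pdivrMr ?mul1r// lt_neqAle eq_sym p0.
Qed.

(** With unit directions u, u' one has <v, v'> = |v||v'| (1 - |u - u'|^2 / 2),
    which is at least half of |v||v'|, while the bracket is |v||v'| [u, u' - u].
    The bound is relative to <v, v'>, so it does not degenerate near the
    vertical axis. *)
Lemma dir_close e p q : 0 <= e -> r%:R * e ^+ 2 <= 1 ->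
  (forall i, `|dir p i - dir q i| <= e) ->
  0 <= dot p q /\ forall ij, `|wedge p q ij| <= 4 * e * dot p q.
Proof.
move=> e0 re hdir.
have dot_ge0 z : 0 <= dot z z.
  by apply: sumr_ge0 => i _; rewrite -expr2 sqr_ge0.
have coord0 z : dot z z = 0 -> forall i, z.1 0 i = 0.
  move=> z0 i; have := le_sum_sqr _ (fun i => z.1 0 i) i.
  under eq_bigr do rewrite expr2.
  rewrite -/(dot z z) z0 => le0; apply/eqP.
  by rewrite -sqrf_eq0 eq_le le0 sqr_ge0.
have degenerate : (forall i, p.1 0 i = 0) \/ (forall i, q.1 0 i = 0) ->
    0 <= dot p q /\ forall ij, `|wedge p q ij| <= 4 * e * dot p q.
  move=> pq0; have -> : dot p q = 0.
    by apply: big1 => i _; case: pq0 => ->; rewrite (mul0r, mulr0).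
  split=> // ij; rewrite mulr0 normr_le0 /wedge.
  by case: pq0 => pq0; rewrite !pq0 !(mul0r, mulr0) subrr.
have [p0|p0] := eqVneq (dot p p) 0; first by apply: degenerate; left; exact: coord0.
have [q0|q0] := eqVneq (dot q q) 0; first by apply: degenerate; right; exact: coord0.
have norm_gt0 z : dot z z != 0 -> 0 < Num.sqrt (dot z z).
  by move=> z0; rewrite sqrtr_gt0 lt_neqAle eq_sym z0 dot_ge0.
have coordE z i : dot z z != 0 -> z.1 0 i = Num.sqrt (dot z z) * dir z i.
  by move=> /norm_gt0 n0; rewrite /dir mulrC divfK// lt0r_neq0.
have dir_unit z : dot z z != 0 -> \sum_i dir z i ^+ 2 = 1.
  move=> z0; under eq_bigr do rewrite /dir exprMn exprVn sqr_sqrtr// expr2.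
  by rewrite -mulr_suml -/(dot z z) divff.
set m := Num.sqrt (dot p p).
set m' := Num.sqrt (dot q q).
have mm0 : 0 < m * m' by rewrite mulr_gt0// norm_gt0.
(* The polarization identity for the unit vectors dir p and dir q. *)
have cosE : \sum_i dir p i * dir q i = 1 - 2^-1 * \sum_i (dir p i - dir q i) ^+ 2.
  have -> : \sum_i (dir p i - dir q i) ^+ 2 = \sum_i dir p i ^+ 2
      + \sum_i dir q i ^+ 2 - 2 * \sum_i dir p i * dir q i.
    by rewrite mulr_sumr -big_split -sumrB; apply: eq_bigr => i _ /=; ring.
  by rewrite !dir_unit//; field.
have sum_le : \sum_i (dir p i - dir q i) ^+ 2 <= 1.
  apply: le_trans re; rewrite -[r in leRHS]card_ord mulr_natl -sumr_const.
  apply: ler_sum => i _; rewrite -real_normK ?num_real//.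
  by rewrite ler_sqr// nnegrE.
have tE : m * m' / 2 <= dot p q.
  have -> : dot p q = m * m' * \sum_i dir p i * dir q i.
    rewrite mulr_sumr; apply: eq_bigr => i _.
    by rewrite (coordE p)// (coordE q)// mulrACA.
  by rewrite ler_pM2l// cosE; lra.
split=> [|[[i j] ij]]; first by apply: le_trans tE; lra.
have -> : wedge p q (exist _ (i, j) ij) =
    m * m' * (dir p i * (dir q j - dir p j) - (dir q i - dir p i) * dir p j).
  rewrite /wedge/= (coordE p i)// (coordE p j)// (coordE q i)// (coordE q j)//.
  by rewrite -/m -/m'; ring.
rewrite normrM (gtr0_norm mm0).
apply: (@le_trans _ _ (m * m' * (2 * e))).
  rewrite ler_pM2l//; apply: le_trans (ler_normB _ _) _.
  rewrite (normrM (dir p i)) (normrM _ (dir p j)).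
  have h k : `|dir q k - dir p k| <= e by rewrite distrC.
  have := ler_pM (normr_ge0 _) (normr_ge0 _) (dir_le1 p i) (h j).
  have := ler_pM (normr_ge0 _) (normr_ge0 _) (h i) (dir_le1 p j).
  by lra.
by have := ler_wpM2r e0 tE; lra.
Qed.

End FreeStep2Geometry.

(** * Colourings for the homogeneous quasi-distance *)

Lemma exists_small (R : realType) (a b : R) : 0 <= a -> 0 < b ->
  exists2 e, 0 < e <= 1 & a * e <= b.
Proof.
move=> a0 b0; exists (b / (a + b)).
  have ab0 : 0 < a + b by lra.
  by rewrite divr_gt0// ler_pdivrMr// mul1r lerDr.
rewrite mulrA ler_pdivrMr; last lra.
by rewrite mulrC ler_pM2l// lerDl ltW.
Qed.

Section HomogeneousDistance.
Variables (R : realType) (r : nat) (rho : R) (d : fr2 R r -> fr2 R r -> R).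
Hypothesis rho_gt0 : 0 < rho.
Hypothesis d_homogeneous : homogeneous_quasi_distance d.
Hypothesis d_ball : qball d 1%g 1 = [set p | enorm p ^+ 2 <= rho ^+ 2].
Implicit Types p q z : fr2 R r.

Let dC p q : d p q = d q p. Proof. by have [[]] := d_homogeneous. Qed.

Let d_ge0 p q : 0 <= d p q. Proof. by have [[]] := d_homogeneous. Qed.

Let d_eq0 p q : d p q = 0 <-> p = q. Proof. by have [[]] := d_homogeneous. Qed.

Lemma dist_from_one p q : d p q = d 1%g (p^-1 * q)%g.
Proof. by have [_ dM _] := d_homogeneous; rewrite -(dM p^-1%g) mulVg. Qed.

Lemma dist_one_dil l z : 0 < l -> d 1%g (dil l z) = l * d 1%g z.
Proof. by have [_ _ dZ] := d_homogeneous; move/dZ <-; rewrite dil_one. Qed.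

Lemma dist_one_le1 z : (d 1%g z <= 1) = (sqn z <= rho ^+ 2).
Proof.
have -> : sqn z = enorm z ^+ 2.
  rewrite /enorm sqr_sqrtr// addr_ge0// sumr_ge0// => i _; exact: sqr_ge0.
by move/seteqP: d_ball => [sub sup]; rewrite dC; apply/idP/idP => [/sub|/sup].
Qed.

Lemma dist_one_le l z : 0 < l -> (d 1%g z <= l) = (sqn (dil l^-1 z) <= rho ^+ 2).
Proof.
move=> l0; rewrite -dist_one_le1 dist_one_dil ?invr_gt0//.
by rewrite ler_pdivrMl// mulr1.
Qed.

(** A point of the unit sphere of [d] is far from the origin for the Euclidean
    norm too: otherwise its dilation by 2 would still lie in the unit ball.  The
    exact value is [rho ^+ 2], but a crude lower bound suffices. *)
Lemma sqn_unit_ge z : d 1%g z = 1 -> rho ^+ 2 / 16 <= sqn z.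
Proof.
move=> z1; rewrite leNgt; apply/negP => lt.
have : d 1%g (dil 2 z) <= 1.
  rewrite dist_one_le1 sqn_dil.
  have : 0 <= \sum_i z.1 0 i ^+ 2 by apply: sumr_ge0 => i _; exact: sqr_ge0.
  by move: lt; rewrite /sqn; lra.
by rewrite dist_one_dil// z1; lra.
Qed.

(** The projection on the unit sphere along the dilations. *)
Definition unit_dil z := dil (d 1%g z)^-1 z.

Lemma dist_one_gt0 z : z <> 1%g -> 0 < d 1%g z.
Proof.
move=> z1; rewrite lt_neqAle d_ge0 andbT eq_sym; apply/eqP => /d_eq0 /esym.
exact: z1.
Qed.

Lemma dist_unit_dil z : z <> 1%g -> d 1%g (unit_dil z) = 1.
Proof.
move=> /dist_one_gt0 z0; rewrite dist_one_dil ?invr_gt0//.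
by rewrite mulVf// lt0r_neq0.
Qed.

Lemma unit_dilK z : z <> 1%g -> dil (d 1%g z) (unit_dil z) = z.
Proof.
by move=> /dist_one_gt0 z0; rewrite dil_dil mulfV ?lt0r_neq0// dil_1.
Qed.

(** Closeness on the unit sphere includes the horizontal directions, which are
    not continuous functions of the point at the vertical axis. *)
Definition unit_close e p q :=
  [/\ forall i, `|p.1 0 i - q.1 0 i| <= e,
      forall ij, `|p.2 ij - q.2 ij| <= e
    & forall i, `|dir p i - dir q i| <= e].

Let n : R := #|{: upair r}|%:R.

(** One [e] serves for all ratios [l] of the distances to the origin, so points
    at comparable and at very different distances need no separate treatment. *)
Lemma exists_besicovitch_radius : exists2 e, 0 < e &
  forall p q l, 0 < l <= 1 -> d 1%g p = 1 -> d 1%g q = 1 ->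
    unit_close e p q -> d 1%g ((dil l q)^-1 * p)%g <= 1.
Proof.
have n0 : 0 <= n by exact: ler0n.
have r0 : 0 <= r%:R :> R by exact: ler0n.
have rho2 : 0 < rho ^+ 2 by exact: exprn_gt0.
(* e must satisfy three smallness conditions: a * e <= 1 controls the bracket
   with delta = 4 * e, r * e <= 1 serves dir_close, and b * e <= 1 bounds the
   distance between p and q. *)
pose a := n * (8 * rho + 4 * rho ^+ 2) * 32.
pose b := 32 * (r%:R + n) / rho ^+ 2.
have a0 : 0 <= a by rewrite /a !mulr_ge0// addr_ge0// mulr_ge0// ltW.
have b0 : 0 <= b by rewrite /b divr_ge0 ?(ltW rho2)// mulr_ge0// addr_ge0.
have [e /andP[e0 e1] small] := exists_small R (a + r%:R + b) 1
  (addr_ge0 (addr_ge0 a0 r0) b0) ltr01.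
exists e => // p q l l01 p1 q1 [pq1 pq2 pqd].
have e2 : e ^+ 2 <= e by rewrite expr2 ger_pMr.
have ae : 0 <= a * e by rewrite mulr_ge0 ?(ltW e0).
have re : 0 <= r%:R * e by rewrite mulr_ge0 ?(ltW e0).
have be : 0 <= b * e by rewrite mulr_ge0 ?(ltW e0).
have [t0 tw] : 0 <= dot p q /\
    forall ij, `|wedge p q ij| <= 4 * e * dot p q.
  apply: dir_close => //; first exact: ltW.
  by have := ler_wpM2l r0 e2; lra.
rewrite dist_one_le1; apply: (@sqn_scaled_diff _ _ _ _ (4 * e)) => //.
- by rewrite mulr_ge0// ltW.
- rewrite -/n; have := ler_wpM2l (mulr_ge0 n0 (ltW rho2)) e2.
  by move: small; rewrite /a in ae *; lra.
- by rewrite -dist_one_le1 p1.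
- by rewrite -dist_one_le1 q1.
- exact: sqn_unit_ge.
- have sq x : `|x| <= e -> x ^+ 2 <= e ^+ 2.
    by move=> xe; rewrite -real_normK ?num_real// ler_sqr ?nnegrE ?(ltW e0).
  apply: (@le_trans _ _ ((r%:R + n) * e ^+ 2)).
    rewrite mulrDl -[r in r%:R]card_ord /n !mulr_natl -!sumr_const.
    by apply: lerD; apply: ler_sum => i _; exact: sq.
  apply: le_trans (ler_wpM2l (addr_ge0 r0 n0) e2) _.
  have : b * e <= 1 by lra.
  by rewrite /b mulrAC ler_pdivrMr//; lra.
Qed.

(** After translating [x] to the origin, each point is coloured by the cell of
    its projection on the unit sphere.  For two points of the same
    colour, dilating the farther one to the unit sphere sends the other one to
    [dil l q] with [q] on the sphere and [l <= 1]. *)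
Lemma besicovitch_coloring : exists K, forall x, colorable K
  (fun p q => d p q <= Num.max (d x p) (d x q)).
Proof.
have [e e0 eP] := exists_besicovitch_radius.
have [K [c cP]] := grid_coloring R ('I_r + upair r + 'I_r)%type (rho + 1) e e0.
pose feat z (k : 'I_r + upair r + 'I_r) : R := match k with
  | inl (inl i) => z.1 0 i | inl (inr ij) => z.2 ij | inr i => dir z i end.
have feat_le z : d 1%g z = 1 -> forall k, `|feat z k| <= rho + 1.
  move=> z1; have : sqn z <= rho ^+ 2 by rewrite -dist_one_le1 z1.
  move=> /(sqn_coord _ _ (ltW rho_gt0))[v w] [[i|ij]|i] /=.
  - by have := v i; lra.
  - by have := w ij; lra.
  - by have := dir_le1 z i; have := rho_gt0; lra.
have close p q : p <> 1%g -> q <> 1%g ->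
    c (feat (unit_dil p)) = c (feat (unit_dil q)) ->
    unit_close e (unit_dil p) (unit_dil q).
  move=> /dist_unit_dil/feat_le fp /dist_unit_dil/feat_le fq.
  move=> /cP/(_ fp fq) h; split=> i.
  - exact: (h (inl (inl i))).
  - exact: (h (inl (inr i))).
  - exact: (h (inr i)).
exists K => x; exists (fun p => c (feat (unit_dil (x^-1 * p)%g))) => p q.
rewrite !(dist_from_one x); set y := (x^-1 * p)%g; set z := (x^-1 * q)%g.
have -> : d p q = d y z.
  by have [_ dM _] := d_homogeneous; rewrite dM.
(* The centre x itself has no projection, but its distance to z is d 1 z. *)
have [->|y1] := pselect (y = 1%g); first by rewrite le_max lexx orbT.
have [->|z1] := pselect (z = 1%g); first by rewrite le_max dC lexx.
move: y z y1 z1 => {p q} y z y1 z1.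
wlog yz : y z y1 z1 / d 1%g z <= d 1%g y.
  move=> IH cE; have /orP[le|le] := le_total (d 1%g z) (d 1%g y).
    exact: IH.
  by rewrite dC maxC; apply: IH.
move=> /(close _ _ y1 z1) yz_close; rewrite le_max; apply/orP; left.
have [y0 z0] := (dist_one_gt0 _ y1, dist_one_gt0 _ z1).
set m := d 1%g y in yz y0 *; set l := d 1%g z / m.
have -> : d y z = m * d 1%g ((dil l (unit_dil z))^-1 * unit_dil y)%g.
  rewrite -dist_one_dil// dil_mul dil_inv dil_dil mulrC divfK ?lt0r_neq0//.
  by rewrite !unit_dilK// -dist_from_one dC.
rewrite ger_pMr//; apply: eP; rewrite ?dist_unit_dil//.
by rewrite divr_gt0// ler_pdivrMr// mul1r.
Qed.

(** By left-invariance and dilations it suffices to treat the unit ball, where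
    all the coordinates are bounded by [rho]; the coordinates of [z^-1 * y] are
    then controlled by those of [y - z]. *)
Lemma ball_coloring e : 0 < e -> exists K, forall x s, 0 < s -> colorable K
  (fun p q => d x p <= s -> d x q <= s -> d p q <= e * s).
Proof.
move=> e0.
have n0 : 0 <= n by exact: ler0n.
have r0 : 0 <= r%:R :> R by exact: ler0n.
have e2 : 0 <= e^-1 ^+ 2 by exact: sqr_ge0.
have e4 : 0 <= e^-1 ^+ 4 by apply: exprn_ge0; rewrite invr_ge0 ltW.
pose A := e^-1 ^+ 2 * r%:R + e^-1 ^+ 4 * (n * (1 + rho) ^+ 2).
have A0 : 0 <= A.
  exact: addr_ge0 (mulr_ge0 e2 r0) (mulr_ge0 e4 (mulr_ge0 n0 (sqr_ge0 _))).
have [h /andP[h0 h1] small] := exists_small R A _ A0 (exprn_gt0 2 rho_gt0).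
have [K [c cP]] := grid_coloring R ('I_r + upair r)%type rho h h0.
pose coord z (k : 'I_r + upair r) : R := match k with
  | inl i => z.1 0 i | inr ij => z.2 ij end.
exists K => x s s0; exists (fun p => c (coord (dil s^-1 (x^-1 * p)%g))) => p q.
rewrite !(dist_from_one x) !dist_one_le//.
set y := dil _ _; set z := dil _ _ => cE hy hz.
have [yv yw] := sqn_coord _ _ (ltW rho_gt0) hy.
have [zv zw] := sqn_coord _ _ (ltW rho_gt0) hz.
have yz : forall k, `|coord y k - coord z k| <= h.
  by apply: cP => // -[]//=.
have dE : d p q = s * d 1%g ((dil 1 z)^-1 * y)%g.
  rewrite dil_1 -dist_from_one -[in LHS](mulVKg x p).
  have [_ dM dZ] := d_homogeneous.
  by rewrite -[q](mulVKg x) dM -dZ// !dil_dil mulfV ?lt0r_neq0// !dil_1 dC.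
rewrite dE mulrC ler_pM2r// dist_one_le// sqn_dil.
apply: le_trans small; apply: (@le_trans _ _ (A * h ^+ 2)); last first.
  by rewrite ler_wpM2l// expr2 ger_pMr.
have sq (t u : R) : 0 <= u -> `|t| <= u -> t ^+ 2 <= u ^+ 2.
  by move=> u0 tu; rewrite -real_normK ?num_real// ler_sqr ?nnegrE.
rewrite /A mulrDl -(mulrA (e^-1 ^+ 2)) -(mulrA (e^-1 ^+ 4)).
apply: lerD; apply: ler_wpM2l => //.
  rewrite mulr_natl -[r in leRHS]card_ord -sumr_const.
  apply: ler_sum => i _; rewrite invM_fst mul1r; apply: sq; first exact: ltW.
  exact: (yz (inl i)).
rewrite -(mulrA n) -exprMn /n mulr_natl -sumr_const; apply: ler_sum => ij _.
rewrite invM_snd expr1n !mul1r.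
apply: sq; first by rewrite mulr_ge0 ?(ltW h0)// addr_ge0// ltW.
have w_le : `|wedge y z ij| <= 2 * (rho * h).
  have -> : wedge y z ij =
      y.1 0 (val ij).1 * (z.1 0 (val ij).2 - y.1 0 (val ij).2)
      - (z.1 0 (val ij).1 - y.1 0 (val ij).1) * y.1 0 (val ij).2.
    by rewrite /wedge; ring.
  apply: le_trans (ler_normB _ _) _; rewrite !normrM mulr_natl mulr2n.
  rewrite ![`|z.1 0 _ - _|]distrC; apply: lerD.
    by apply: ler_pM => //; exact: (yz (inl _)).
  by rewrite mulrC; apply: ler_pM => //; exact: (yz (inl _)).
apply: le_trans (ler_normD _ _) _; rewrite normrM.
rewrite [`|2^-1|]ger0_norm ?invr_ge0//; have /= := yz (inr ij); lra.
Qed.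

End HomogeneousDistance.

(** * The covering property *)

Theorem theorem4p5 (R : realType) (r : nat) (hr : (2 <= r)%N)
    (rho : R) (hrho : 0 < rho) (d : fr2 R r -> fr2 R r -> R)
    (hd : homogeneous_quasi_distance d)
    (hball : qball d 1%g 1 = [set p | enorm p ^+ 2 <= rho ^+ 2]) :
  BCP d.
Proof.
apply: BCP_of_colorings.
- by have [] := hd.
- exact: besicovitch_coloring hrho hd hball.
- exact: ball_coloring hrho hd hball.
Qed.
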